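(* Let $\mathfrak{M}\subseteq\mathbb{R}^n$ be a nonempty closed set, $d(x)=\mathrm{dist}(x,\mathfrak{M})$, and let $\ell\in C(\mathbb{R}^n)$ be bounded, with $\ell(x)>0$ for $x\in\mathbb{R}^n\setminus\mathfrak{M}$ and $\ell\equiv0$ on $\mathfrak{M}$. Assume that for all $\delta>0$ there exists $\gamma(\delta)>0$ such that $$\inf\{\ell(x):\ d(x)>\delta\}>\gamma(\delta),$$ and that there exist $r>0$ and a continuous function $\tilde\gamma:[0,+\infty)\to[0,+\infty)$ with $\tilde\gamma(0)=0$ and $\tilde\gamma(s)>0$ for all $s>0$ such that $$\ell(x)=\tilde\gamma(d(x))\qquad\text{for all }x\text{ with }d(x)\le r.$$ Let $\alpha^*$ be an optimal control, for the initial point $x$, of the problem $v(x)=\inf_\alpha\int_0^{t_x(\alpha)}\ell(y_x^\alpha(s))\,ds$. Then $t_x(\alpha^* )=d(x)$ whenever $d(x)\le r$, and $t_x(\alpha^* )$ is finite for all $x\in\mathbb{R}^n$.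
   Context: An admissible control is a measurable function $\alpha:[0,+\infty)\to B(0,1)$, where $B(0,1)$ is the closed unit ball of $\mathbb{R}^n$. Its trajectory from $x$ is $y_x^\alpha(t)=x+\int_0^t\alpha(s)\,ds$, and its hitting time is $t_x(\alpha)=\inf\{s\ge0: y_x^\alpha(s)\in\mathfrak{M}\}\in[0,+\infty]$. The infimum defining $v(x)$ is over admissible controls; $\alpha^*$ is optimal for $x$ if $\int_0^{t_x(\alpha^* )}\ell(y_x^{\alpha^*}(s))\,ds=v(x)$. *)

(* Defs.v *)
From HB Require Import structures.
From mathcomp Require Import all_boot all_order all_algebra.
From mathcomp Require Import all_classical all_reals all_analysis.

Set Implicit Arguments.
Unset Strict Implicit.
Unset Printing Implicit Defensive.

Import Order.TTheory GRing.Theory Num.Theory.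
Import numFieldNormedType.Exports.

Local Open Scope classical_set_scope.
Local Open Scope ring_scope.

(* The library's norm on ['rV[R]_n] is the max norm; it induces the usual
   topology, but unit balls and distances have to be Euclidean. *)
Definition enorm (R : realType) (n : nat) (x : 'rV[R]_n) : R :=
  Num.sqrt (\sum_(i < n) x ord0 i ^+ 2).

Definition dist_to (R : realType) (n : nat) (M : set 'rV[R]_n)
    (x : 'rV[R]_n) : R :=
  inf [set enorm (x - m) | m in M].

(* The real line with its Lebesgue sigma-algebra, on which
   [completed_lebesgue_measure] lives; the default structure on [R] is Borel. *)
Notation lebesgueR R := (caratheodory_type ((@wlength R idfun)^*)%mu).

Notation borel_rV R n := (g_sigma_algebraType (@open 'rV[R]_n)).

(* A control is represented by a function on the whole line whose values at
   negative times are irrelevant. *)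
Definition admissible (R : realType) (n : nat) (alpha : R -> 'rV[R]_n) : Prop :=
  measurable_fun (`[0, +oo[ : set (lebesgueR R))
    (alpha : lebesgueR R -> borel_rV R n) /\
  forall s : R, 0 <= s -> enorm (alpha s) <= 1.

Definition trajectory (R : realType) (n : nat) (x : 'rV[R]_n)
    (alpha : R -> 'rV[R]_n) (t : R) : 'rV[R]_n :=
  x + \row_(i < n)
        \int[@completed_lebesgue_measure R]_(s in `[0, t]) alpha s ord0 i.

(* The infimum of the empty set is [+oo]. *)
Definition hitting_time (R : realType) (n : nat) (M : set 'rV[R]_n)
    (x : 'rV[R]_n) (alpha : R -> 'rV[R]_n) : \bar R :=
  ereal_inf [set s%:E | s in [set s : R | 0 <= s /\ M (trajectory x alpha s)]].

Definition cost (R : realType) (n : nat) (M : set 'rV[R]_n)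
    (l : 'rV[R]_n -> R) (x : 'rV[R]_n) (alpha : R -> 'rV[R]_n) : \bar R :=
  (\int[@completed_lebesgue_measure R]_(s in
      [set s : R | (0 <= s)%R /\ (s%:E <= hitting_time M x alpha)%E])
     (l (trajectory x alpha s))%:E)%E.

Definition value (R : realType) (n : nat) (M : set 'rV[R]_n)
    (l : 'rV[R]_n -> R) (x : 'rV[R]_n) : \bar R :=
  ereal_inf [set cost M l x alpha | alpha in @admissible R n].

Definition optimal (R : realType) (n : nat) (M : set 'rV[R]_n)
    (l : 'rV[R]_n -> R) (x : 'rV[R]_n) (alpha : R -> 'rV[R]_n) : Prop :=
  admissible alpha /\ cost M l x alpha = value M l x.

(* Main.v *)
(* Let delta(s) be the distance to M along a trajectory and G the primitive of
   gt vanishing at 0. As delta is 1-Lipschitz, G(min(delta, r)) decreases at rate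
   at most gt(delta) = l while delta <= r, so the sum of the running cost and
   G(min(delta, r)) is nondecreasing: getting from distance delta <= r to M costs
   at least G(delta), and this is what the straight segment to the nearest point
   costs. If the target is missed at the time the segment would hit it, then on
   some longer interval the cost is at least eta > 0; subtracting eta from both
   l and gt in the same argument shows that the trajectory pays strictly more
   than the segment. Finally a trajectory of finite cost cannot stay at distance
   > r from M forever, and applying the above from a time at which the distance
   is at most r bounds the hitting time. *)
Require Import Defs.
From HB Require Import structures.
From mathcomp Require Import all_boot all_order all_algebra.
From mathcomp Require Import all_classical all_reals all_analysis.
From mathcomp Require Import measurable_realfun ring lra.

Set Implicit Arguments.
Unset Strict Implicit.
Unset Printing Implicit Defensive.

Import Order.TTheory GRing.Theory Num.Theory.
Import numFieldNormedType.Exports.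

Local Open Scope classical_set_scope.
Local Open Scope ring_scope.

(** * Integrals over [[0, t]] *)

Notation integrable_upto f t :=
  (integrable (@completed_lebesgue_measure _) `[0, t] (EFin \o f)).

Section running_integral.
Context {R : realType}.
Implicit Types (f : R -> R) (a b c s t e : R).

Lemma lebesgueR_measurable (A : set R) :
  measurable A -> measurable (A : set (lebesgueR R)).
Proof. exact: sub_caratheodory. Qed.

Lemma completed_lebesgue_measure_oc a b : a <= b ->
  @completed_lebesgue_measure R `]a, b] = (b - a)%:E.
Proof.
(* The completed measure and [lebesgue_measure] are the same set function on different
   sigma-algebras, so this step is a mere conversion. *)
move=> ab; transitivity (@lebesgue_measure R `]a, b]); first by [].
rewrite lebesgue_measure_itv/= lte_fin -EFinB; case: ltgtP ab => // -> _.
by rewrite subrr.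
Qed.

Lemma completed_lebesgue_measure_cc a b : a <= b ->
  @completed_lebesgue_measure R `[a, b] = (b - a)%:E.
Proof.
move=> ab; transitivity (@lebesgue_measure R `[a, b]); first by [].
rewrite lebesgue_measure_itv/= lte_fin -EFinB; case: ltgtP ab => // -> _.
by rewrite subrr.
Qed.

Lemma continuous_lebesgueR_measurable f : continuous f ->
  measurable_fun setT (f : lebesgueR R -> R).
Proof.
move=> cf _ B mB; rewrite setTI; apply: lebesgueR_measurable.
by rewrite -[X in measurable X]setTI; exact: continuous_measurable_fun.
Qed.

(** It serves both as the running cost up to time [t] and as the primitive of the radial cost,
    evaluated at a distance. For [t < 0] the interval is empty and the value is 0. *)
Definition iint f t : R := \int[@completed_lebesgue_measure R]_(s in `[0, t]) f s.

Lemma continuous_integrable_upto f t : continuous f -> integrable_upto f t.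
Proof.
move=> cf; have [t0|t0] := leP 0 t; last first.
  by rewrite set_itv_ge ?bnd_simp -?ltNge//; exact: integrable_set0.
apply: measurable_bounded_integrable => /=.
- exact: lebesgueR_measurable.
- by rewrite completed_lebesgue_measure_cc// ltry.
- by apply: measurable_funTS; exact: continuous_lebesgueR_measurable.
- have := @segment_compact R 0 t.
  have cf' : {within `[0, t], continuous f} by exact: continuous_subspaceT.
  by move=> /(continuous_compact cf') /compact_bounded [M [Mr HM]];
     exists M; split => // x Mx s sI; apply: (HM _ Mx); exists s.
Qed.

(** The half-open interval keeps the two pieces disjoint, so no null set has to be discarded. *)
Lemma iint_sub f a b : 0 <= a -> a <= b -> integrable_upto f b ->
  iint f b - iint f a = \int[@completed_lebesgue_measure R]_(s in `]a, b]) f s.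
Proof.
move=> a0 ab fb; rewrite /iint (@itv_bndbnd_setU _ _ (BLeft 0) (BRight a))//.
rewrite Rintegral_setU.
- by rewrite addrC addKr.
- exact: lebesgueR_measurable.
- exact: lebesgueR_measurable.
- by rewrite -itv_bndbnd_setU.
- apply/disj_setPS => y [/=]; rewrite 2!in_itv/= => /andP[_ ya] /andP[].
  by rewrite ltNge ya.
Qed.

Lemma integrable_upto_le f a b : a <= b -> integrable_upto f b ->
  integrable_upto f a.
Proof.
move=> ab; apply: integrableS; [exact: lebesgueR_measurable..|].
by apply: subset_itvl; rewrite bnd_simp.
Qed.

Lemma iint_ge f a b c : 0 <= a -> a <= b -> integrable_upto f b ->
  (forall s, a <= s <= b -> c <= f s) -> c * (b - a) <= iint f b - iint f a.
Proof.
move=> a0 ab fb cf; rewrite iint_sub//.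
have mab : measurable (`]a, b] : set (lebesgueR R)) by exact: lebesgueR_measurable.
have -> : c * (b - a) = \int[@completed_lebesgue_measure R]_(s in `]a, b]) c.
  rewrite Rintegral_cst//.
  by rewrite -[X in fine X]/(completed_lebesgue_measure `]a, b]) completed_lebesgue_measure_oc.
apply: le_Rintegral => //.
- apply: measurable_bounded_integrable => //=.
    by rewrite completed_lebesgue_measure_oc// ltry.
  exact: bounded_cst.
- apply: integrableS fb => //; first exact: lebesgueR_measurable.
  by move=> x/=; rewrite !in_itv/= => /andP[ax ->]; rewrite (le_trans a0)// ltW.
- by move=> x /=; rewrite in_itv/= => /andP[ax xb]; rewrite cf// xb ltW.
Qed.

Lemma iintN f t : integrable_upto f t -> iint (fun s => - f s) t = - iint f t.
Proof.
move=> ft; rewrite -mulN1r /iint -RintegralZl//; last exact: lebesgueR_measurable.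
by apply: eq_Rintegral => x _; rewrite mulN1r.
Qed.

Lemma iint_le f a b c : 0 <= a -> a <= b -> integrable_upto f b ->
  (forall s, a <= s <= b -> f s <= c) -> iint f b - iint f a <= c * (b - a).
Proof.
move=> a0 ab fb fc; have fNb : integrable_upto (fun s => - f s) b.
  have mb : measurable (`[0, b] : set (lebesgueR R)) by exact: lebesgueR_measurable.
  have -> : EFin \o (fun s => - f s) = -%E \o (EFin \o f) by apply/funext.
  exact: integrableN.
have := @iint_ge (fun s => - f s) a b (- c) a0 ab fNb.
rewrite !iintN//; last exact: integrable_upto_le fb.
by rewrite mulNr -opprD lerN2; apply => s sab; rewrite lerN2 fc.
Qed.

(** This is strict differentiability of the primitive at [s]: both endpoints move, as
    [nondecreasing_of_local] requires. It holds because [f] stays within [e] of [f s] between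
    them. *)
Lemma iint_near f s e : continuous f -> 0 < e ->
  exists2 d, 0 < d & forall a b, 0 <= a -> a <= b -> s - d < a -> b < s + d ->
    `|iint f b - iint f a - f s * (b - a)| <= e * (b - a).
Proof.
move=> cf e0; have /cvgrPdist_le/(_ _ e0) := cf s.
move=> /nbhs_ballP[d /= d0 Hd]; exists d => // a b a0 ab da db.
have fd t : a <= t <= b -> `|f s - f t| <= e.
  by move=> /andP[at_ tb]; apply: Hd; rewrite /ball/= ltr_norml; lra.
have fb := continuous_integrable_upto b cf.
rewrite ler_norml; apply/andP; split.
  have := @iint_ge f a b (f s - e) a0 ab fb.
  rewrite mulrBl => H; have {}H : f s * (b - a) - e * (b - a) <= iint f b - iint f a.
    by apply: H => t /fd; rewrite ler_norml; lra.
  by lra.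
have := @iint_le f a b (f s + e) a0 ab fb.
rewrite mulrDl => H; have {}H : iint f b - iint f a <= f s * (b - a) + e * (b - a).
  by apply: H => t /fd; rewrite ler_norml; lra.
by lra.
Qed.

Lemma iint_le0 f t : t <= 0 -> iint f t = 0.
Proof.
rewrite /iint le_eqVlt => /predU1P[->|t0]; last first.
  by rewrite set_itv_ge ?bnd_simp -?ltNge// Rintegral_set0.
rewrite (@eq_Rintegral _ _ _ _ _ (cst (f 0))); last first.
  by move=> x; rewrite inE/= in_itv/= => x0; congr f; apply: le_anti; lra.
rewrite Rintegral_cst; last exact: lebesgueR_measurable.
rewrite -[X in fine X]/(completed_lebesgue_measure `[0, 0]).
by rewrite completed_lebesgue_measure_cc// subrr mulr0.
Qed.

End running_integral.

(* The hypothesis is a lower Dini derivative bound in straddling form, which is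
   what makes a one-line supremum argument possible. *)
Lemma nondecreasing_of_local (R : realType) (f : R -> R) (a b : R) : a <= b ->
  (forall s e, a <= s <= b -> 0 < e -> exists2 d, 0 < d &
    forall u v, a <= u -> v <= b -> u <= s -> s <= v -> s - d < u -> v < s + d ->
      f v - f u >= - (e * (v - u))) ->
  f a <= f b.
Proof.
move=> ab Hf; apply/ler_addgt0Pr => e0 e0_gt0.
(* The total loss [e * (b - a)] then stays below [e0]; the [+ 1] keeps the denominator positive when
   [a = b]. *)
pose e := e0 / (b - a + 1).
have e_gt0 : 0 < e by rewrite divr_gt0//; lra.
suff H : f a - e * (b - a) <= f b.
  have : e * (b - a) <= e0.
    by rewrite /e mulrAC ler_pdivrMr ?ler_wpM2l//; [exact: ltW|lra|lra].
  by lra.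
(* [A] collects the points where [f] has lost at most [e] per unit of length since [a]. Its supremum
   is shown to lie in [A], and then to be [b]. *)
pose A := [set t | a <= t <= b /\ f a - e * (t - a) <= f t].
have Aa : A a by split; [rewrite lexx|rewrite subrr mulr0 subr0].
have supA : has_sup A by split; [exists a|exists b => t [/andP[]]].
have acb : a <= sup A <= b.
  rewrite ub_le_sup//=; last by case: supA.
  by apply: ge_sup; [exists a|move=> t [/andP[]]].
have [d d0 Hd] := Hf _ _ acb e_gt0.
have [t At tsup] := sup_adherent d0 supA.
have tA : t <= sup A by apply: ub_le_sup => //; case: supA.
case: At => /andP[at_ tb] ft.
have {ft}fc : f a - e * (sup A - a) <= f (sup A).
  have := Hd t (sup A); rewrite at_ tA lexx tsup; case/andP: acb => _ ->.
  by rewrite ltrDl d0 => /(_ isT isT isT isT isT isT); lra.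
have [cb|cb] : sup A = b \/ sup A < b.
  by case/andP: acb => _; rewrite le_eqVlt => /orP[/eqP|]; [left|right].
  by move: fc; rewrite cb.
(* If [sup A < b], the local bound between [sup A] and [v] carries the estimate beyond the supremum,
   which is absurd. *)
pose v := Num.min b (sup A + d / 2).
have vb : v <= b by rewrite /v ge_min lexx.
have cv : sup A < v by rewrite /v lt_min cb/=; lra.
have vd : v < sup A + d by rewrite /v gt_min; apply/orP; right; lra.
have Av : A v.
  split; first by lra.
  have := Hd (sup A) v; rewrite lexx vb vd (ltW cv) (andP acb).1.
  by rewrite ltrBlDr ltrDl d0 => /(_ isT isT isT isT isT isT); lra.
have : v <= sup A by apply: ub_le_sup => //; case: supA.
by rewrite leNgt cv.
Qed.

(** * Euclidean norm and distance *)

Section euclidean_norm.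
Context {R : realType} {n : nat}.
Implicit Types (u v w x y : 'rV[R]_n) (M : set 'rV[R]_n).

Lemma enorm_ge0 u : 0 <= enorm u.
Proof. exact: sqrtr_ge0. Qed.

Lemma enorm_sqr u : enorm u ^+ 2 = \sum_(i < n) u ord0 i ^+ 2.
Proof. by rewrite sqr_sqrtr// sumr_ge0// => i _; rewrite sqr_ge0. Qed.

Lemma coord_le_enorm u i : `|u ord0 i| <= enorm u.
Proof.
rewrite -(@ler_pXn2r _ 2)// ?nnegrE ?enorm_ge0// enorm_sqr real_normK ?num_real//.
by rewrite (bigD1 i)//= lerDl sumr_ge0// => j _; rewrite sqr_ge0.
Qed.

Lemma enorm_eq0 u : enorm u = 0 -> u = 0.
Proof.
move=> u0; apply/rowP => i; rewrite mxE; apply/normr0_eq0/eqP.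
by rewrite eq_le normr_ge0 andbT -u0 coord_le_enorm.
Qed.

Lemma enorm0 : enorm (0 : 'rV[R]_n) = 0.
Proof. by rewrite /enorm big1 ?sqrtr0// => i _; rewrite mxE expr0n. Qed.

Lemma enormZ (c : R) u : enorm (c *: u) = `|c| * enorm u.
Proof.
rewrite /enorm -sqrtr_sqr -sqrtrM ?sqr_ge0// mulr_sumr; congr Num.sqrt.
by apply: eq_bigr => i _; rewrite mxE exprMn.
Qed.

Lemma enormN u : enorm (- u) = enorm u.
Proof. by rewrite -scaleN1r enormZ normrN1 mul1r. Qed.

Lemma enorm_distC u v : enorm (u - v) = enorm (v - u).
Proof. by rewrite -enormN opprB. Qed.

(** Cauchy-Schwarz: expand the sum of the squares of the coordinates of
    [enorm v *: u - enorm u *: v] and divide by the product of the norms; hence the separate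
    treatment of zero vectors. *)
Lemma dot_le_enorm u v :
  \sum_(i < n) u ord0 i * v ord0 i <= enorm u * enorm v.
Proof.
have [->|u0] := eqVneq u 0.
  by rewrite enorm0 mul0r big1// => i _; rewrite mxE mul0r.
have [->|v0] := eqVneq v 0.
  by rewrite enorm0 mulr0 big1// => i _; rewrite mxE mulr0.
have pos w : w != 0 -> 0 < enorm w.
  by move=> w0; rewrite lt_neqAle enorm_ge0 andbT eq_sym;
     apply: contra_neq w0; exact: enorm_eq0.
have ab0 := mulr_gt0 (pos _ u0) (pos _ v0).
have : 0 <= \sum_(i < n) (enorm v * u ord0 i - enorm u * v ord0 i) ^+ 2.
  by rewrite sumr_ge0// => i _; rewrite sqr_ge0.
have -> : \sum_(i < n) (enorm v * u ord0 i - enorm u * v ord0 i) ^+ 2 =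
    enorm v ^+ 2 * enorm u ^+ 2 + enorm u ^+ 2 * enorm v ^+ 2
    - 2 * (enorm u * enorm v) * \sum_(i < n) u ord0 i * v ord0 i.
  (* One factor of each product is folded back into a norm, so that every term is a scalar times a
     single sum and the identity can be checked termwise. *)
  rewrite !enorm_sqr -[in X in X * _ + _]enorm_sqr -[in X in _ + X * _]enorm_sqr.
  rewrite !mulr_sumr -big_split/= -sumrB.
  by apply: eq_bigr => i _; ring.
set S := \sum_(i < n) _; set a := enorm u in ab0 *; set b := enorm v in ab0 *.
move=> H; rewrite -(ler_pM2l ab0).
have : b ^+ 2 * a ^+ 2 + a ^+ 2 * b ^+ 2 = 2 * (a * b * (a * b)) by ring.
by rewrite -mulrA in H; lra.
Qed.

Lemma enormD u v : enorm (u + v) <= enorm u + enorm v.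
Proof.
rewrite -(@ler_pXn2r _ 2)// ?nnegrE ?addr_ge0 ?enorm_ge0//.
rewrite [leRHS]sqrrD !enorm_sqr.
have -> : \sum_(i < n) (u + v) ord0 i ^+ 2 = \sum_(i < n) u ord0 i ^+ 2 +
   \sum_(i < n) u ord0 i * v ord0 i *+ 2 + \sum_(i < n) v ord0 i ^+ 2.
  by rewrite -!big_split/=; apply: eq_bigr => i _; rewrite mxE sqrrD.
by rewrite lerD2r lerD2l sumrMnl lerMn2r dot_le_enorm.
Qed.

Lemma enorm_continuous : continuous (@enorm R n).
Proof.
move=> u; apply: (@continuous_comp _ _ _
  (fun w : 'rV[R]_n => \sum_(i < n) w ord0 i ^+ 2) Num.sqrt u); last exact: sqrt_continuous.
apply: continuous_big => [|i _ w]; first exact: add_continuous.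
exact: (@continuous_comp _ _ _ (fun w : 'rV[R]_n => w ord0 i)
  (fun c : R => c ^+ 2) w (@coord_continuous _ _ _ ord0 i w) (@exprn_continuous _ 2 _)).
Qed.

Lemma dist_to_has_inf M x : M !=set0 -> has_inf [set enorm (x - m) | m in M].
Proof.
move=> [m Mm]; split; first by exists (enorm (x - m)), m.
by exists 0 => _ [m' _ <-]; exact: enorm_ge0.
Qed.

Lemma dist_to_le M x m : M m -> dist_to M x <= enorm (x - m).
Proof.
move=> Mm; apply: ge_inf; last by exists m.
by apply: (dist_to_has_inf _ _).2; exists m.
Qed.

Lemma dist_to_ge M x c : M !=set0 -> (forall m, M m -> c <= enorm (x - m)) ->
  c <= dist_to M x.
Proof.
move=> [m Mm] cM; apply: lb_le_inf; first by exists (enorm (x - m)), m.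
by move=> _ [m' Mm' <-]; exact: cM.
Qed.

Lemma dist_to_ge0 M x : M !=set0 -> 0 <= dist_to M x.
Proof. by move=> M0; apply: dist_to_ge => // m _; exact: enorm_ge0. Qed.

Lemma dist_to_mem M x : M x -> dist_to M x = 0.
Proof.
move=> Mx; apply/eqP; rewrite eq_le dist_to_ge0 ?andbT; last by exists x.
by rewrite (le_trans (dist_to_le _ Mx))// subrr enorm0.
Qed.

Lemma dist_to_lipschitz M x y : M !=set0 ->
  dist_to M x <= dist_to M y + enorm (x - y).
Proof.
move=> M0; rewrite -lerBlDr; apply: dist_to_ge => // m Mm.
rewrite lerBlDr (le_trans (dist_to_le _ Mm))//.
have -> : x - m = y - m + (x - y) by rewrite [RHS]addrC addrA subrK.
exact: enormD.
Qed.

(** Only the points of [M] no farther from [x] than some fixed [m0] compete. They form a closed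
    bounded set, hence a compact one, on which the continuous function [enorm (x - m)] has a
    minimum. *)
Lemma dist_to_attained M x : M !=set0 -> closed M ->
  exists2 m, M m & enorm (x - m) = dist_to M x.
Proof.
move=> [m0 Mm0] cM.
pose A := M `&` [set m | enorm (x - m) <= enorm (x - m0)].
have cf : continuous (fun m : 'rV[R]_n => enorm (x - m)).
  move=> m; apply: (@continuous_comp _ _ _ (fun m : 'rV[R]_n => x - m) (@enorm R n) m).
    apply: (@continuousB R _ _ (cst x) id m); [exact: cst_continuous|exact: cvg_id].
  exact: enorm_continuous.
have A0 : A !=set0 by exists m0; split => /=.
have cA : closed A.
  apply: closedI => //.
  exact: ((continuous_closedP _).1 cf _ (@closed_le R (enorm (x - m0)))).
(* Boundedness refers to the max norm, which the Euclidean norm dominates. *)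
have bA : bounded_set A.
  exists (enorm (x - m0) + enorm x); split; first exact: num_real.
  move=> K HK m [_ /= Hm]; apply: (le_trans _ (ltW HK)).
  rewrite [leLHS]/Num.norm/= mx_normrE; apply/bigmax_leP.
  split; first by rewrite addr_ge0// enorm_ge0.
  move=> [i j] _ /=; rewrite (ord1 i) (le_trans (coord_le_enorm _ _))//.
  rewrite -[m](subrK x) (le_trans (enormD _ _))// lerD2r.
  by rewrite (enorm_distC m x).
have cf' : {within A, continuous (fun m : 'rV[R]_n => enorm (x - m))}.
  exact: continuous_subspaceT.
have [m /set_mem[Mm Am] Hm] := EVT_min_rV A0 (bounded_closed_compact bA cA) cf'.
exists m => //; apply/eqP; rewrite eq_le dist_to_le// andbT.
apply: dist_to_ge; first by exists m0.
move=> m' Mm'; have [le|lt] := leP (enorm (x - m')) (enorm (x - m0)).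
  by apply: Hm; rewrite inE.
exact: le_trans Am (ltW lt).
Qed.

Lemma dist_to_eq0 M x : M !=set0 -> closed M -> dist_to M x = 0 -> M x.
Proof.
move=> M0 cM dx; have [m Mm] := dist_to_attained x M0 cM.
by rewrite dx => /enorm_eq0/subr0_eq ->.
Qed.

End euclidean_norm.

(** * Trajectories *)

Section trajectories.
Context {R : realType} {n : nat}.
Implicit Types (x u : 'rV[R]_n) (alpha : R -> 'rV[R]_n) (s t : R).

Lemma trajectoryE x alpha t i :
  trajectory x alpha t ord0 i = x ord0 i + iint (fun s => alpha s ord0 i) t.
Proof. by rewrite /trajectory !mxE. Qed.

Lemma trajectory_le0 x alpha t : t <= 0 -> trajectory x alpha t = x.
Proof.
move=> t0; apply/rowP => i; rewrite trajectoryE.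
by rewrite iint_le0// addr0.
Qed.

(** Open intervals generate the Borel sets of the line, and their preimages under a coordinate are
    open. *)
Lemma coord_measurable i :
  measurable_fun setT ((fun w => w ord0 i) : borel_rV R n -> R).
Proof.
apply: (measurability _ (RGenOpens.measurableE R)) .
move=> _ [_ [a [b ->] <-]]; rewrite setTI; apply: sub_sigma_algebra => /=.
by apply: open_comp; [move=> w _; exact: coord_continuous|exact: interval_open].
Qed.

Lemma admissible_coord_measurable alpha i : admissible alpha ->
  measurable_fun (`[0, +oo[ : set (lebesgueR R))
    ((fun s => alpha s ord0 i) : lebesgueR R -> R).
Proof.
by move=> [ma _]; apply: (measurable_comp _ _ (coord_measurable i) ma).
Qed.

Lemma admissible_integrable_upto alpha i t : admissible alpha ->
  integrable_upto (fun s => alpha s ord0 i) t.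
Proof.
move=> adm; have [t0|t0] := leP 0 t; last first.
  by rewrite set_itv_ge ?bnd_simp -?ltNge//; exact: integrable_set0.
apply: measurable_bounded_integrable => /=.
- exact: lebesgueR_measurable.
- by rewrite completed_lebesgue_measure_cc// ltry.
- apply: measurable_funS (admissible_coord_measurable i adm).
    exact: lebesgueR_measurable.
  by apply: subset_itvl; rewrite bnd_simp.
- exists 1; split; first exact: num_real.
  move=> K K1 s/=; rewrite in_itv/= => /andP[s0 _].
  by rewrite (le_trans (coord_le_enorm _ _))// (le_trans (adm.2 _ s0))// ltW.
Qed.

(** Both claims go through one induction, since additivity needs the tail to be integrable. The
    purpose is to integrate the inner product of a control with a fixed vector. *)
Lemma iint_sum (I : Type) (r : seq I) (c : I -> R) (f : I -> R -> R) t :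
  (forall i, integrable_upto (f i) t) ->
  integrable_upto (fun s => \sum_(i <- r) c i * f i s) t /\
  iint (fun s => \sum_(i <- r) c i * f i s) t = \sum_(i <- r) c i * iint (f i) t.
Proof.
move=> fi; have mt : measurable (`[0, t] : set (lebesgueR R)).
  exact: lebesgueR_measurable.
have cfi i : integrable_upto (fun s => c i * f i s) t.
  have -> : EFin \o (fun s => c i * f i s) = (fun s => (c i)%:E * (EFin \o f i) s)%E.
    by apply/funext => s.
  exact: integrableZl.
elim: r => [|i r [IHi IHe]].
  rewrite big_nil (_ : (fun s => _) = cst 0); last first.
    by apply/funext => s; rewrite big_nil.
  split; first exact: integrable0.
  by rewrite /iint Rintegral_cst// mul0r.
rewrite big_cons (_ : (fun s => _) =
  (fun s => c i * f i s + \sum_(j <- r) c j * f j s)); last first.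
  by apply/funext => s; rewrite big_cons.
split.
  have -> : EFin \o (fun s => c i * f i s + \sum_(j <- r) c j * f j s) =
      ((EFin \o (fun s => c i * f i s)%R) \+
       (EFin \o (fun s => \sum_(j <- r) c j * f j s)%R))%E.
    by apply/funext => s.
  exact: integrableD.
by rewrite -IHe /iint RintegralD// RintegralZl.
Qed.

(** Integrals are taken coordinatewise, so the increment [v] is tested against itself:
    [enorm v ^+ 2] is the integral over the time span of the inner product of [v] with the control,
    at most [enorm v * (t - s)] by Cauchy-Schwarz. *)
Lemma trajectory_lipschitz x alpha s t : admissible alpha -> 0 <= s -> s <= t ->
  enorm (trajectory x alpha t - trajectory x alpha s) <= t - s.
Proof.
move=> adm s0 st; set v := _ - _.
have [->|v0] := eqVneq v 0; first by rewrite enorm0 subr_ge0.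
have v_gt0 : 0 < enorm v.
  by rewrite lt_neqAle enorm_ge0 andbT eq_sym; apply: contra_neq v0; exact: enorm_eq0.
rewrite -(ler_pM2l v_gt0) -expr2 enorm_sqr.
have [_ It] := @iint_sum _ (index_enum 'I_n) (v ord0) (fun i s => alpha s ord0 i) t
  (fun i => admissible_integrable_upto i t adm).
have [_ Is] := @iint_sum _ (index_enum 'I_n) (v ord0) (fun i s => alpha s ord0 i) s
  (fun i => admissible_integrable_upto i s adm).
have -> : \sum_(i < n) v ord0 i ^+ 2 =
    \sum_(i < n) v ord0 i * iint (fun s => alpha s ord0 i) t -
    \sum_(i < n) v ord0 i * iint (fun s => alpha s ord0 i) s.
  rewrite -sumrB; apply: eq_bigr => i _; rewrite -mulrBr expr2; congr (_ * _).
  by rewrite /v !mxE /iint; ring.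
rewrite -It -Is; apply: iint_le => //.
  by apply: (@iint_sum _ _ _ (fun i s => alpha s ord0 i) t _).1 => i;
     exact: admissible_integrable_upto.
move=> w /andP[sw _]; rewrite (le_trans (dot_le_enorm _ _))//.
by rewrite ler_piMr ?enorm_ge0// adm.2// (le_trans s0).
Qed.

Lemma trajectory_continuous x alpha : admissible alpha ->
  continuous (trajectory x alpha).
Proof.
move=> adm.
(* The trajectory rests at [x] at negative times, so the Lipschitz bound extends to the whole
   line. *)
have lip s t : s <= t -> enorm (trajectory x alpha t - trajectory x alpha s) <= t - s.
  move=> st; have [s0|s0] := leP 0 s; first exact: trajectory_lipschitz.
  have [t0|t0] := leP 0 t.
    rewrite (trajectory_le0 _ _ (ltW s0)).
    have := trajectory_lipschitz x adm (lexx 0) t0.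
    by rewrite (trajectory_le0 _ _ (lexx 0)) => /le_trans; apply; lra.
  by rewrite !trajectory_le0 ?(ltW s0) ?(ltW t0)// subrr enorm0; lra.
move=> s; apply/cvgrPdist_le => e e0; near=> t.
have H : enorm (trajectory x alpha s - trajectory x alpha t) <= `|s - t|.
  have [st|ts] := leP s t.
    by rewrite enorm_distC distrC ger0_norm ?subr_ge0// lip.
  by rewrite ger0_norm ?subr_ge0 ?(ltW ts)// lip// ltW.
have {}H : enorm (trajectory x alpha s - trajectory x alpha t) <= e.
  by rewrite (le_trans H)//; near: t; exact: cvgr_dist_le.
rewrite [leLHS]/Num.norm/= mx_normrE; apply/bigmax_leP; split; first exact: ltW.
by move=> [i j] _ /=; rewrite (ord1 i) (le_trans (coord_le_enorm _ _)).
Unshelve. all: by end_near. Qed.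

(** Time [s0] itself still follows [alpha], which matches the splitting of time into a closed
    interval ending at [s0] and an interval open at [s0]. *)
Definition switch_control alpha s0 u : R -> 'rV[R]_n :=
  fun s => if s <= s0 then alpha s else u.

Lemma switch_control_admissible alpha s0 u : 0 <= s0 -> admissible alpha ->
  enorm u <= 1 -> admissible (switch_control alpha s0 u).
Proof.
move=> s00 [ma aM] u1; split; last first.
  by move=> s s_ge0; rewrite /switch_control; case: ifP => // _; exact: aM.
rewrite (@itv_bndbnd_setU _ _ (BLeft 0) (BRight s0))//.
apply/measurable_funU; [exact: lebesgueR_measurable..|split].
  apply: (@eq_measurable_fun _ _ _ _ _ (alpha : lebesgueR R -> borel_rV R n)).
    by move=> s; rewrite inE/= in_itv/= /switch_control => /andP[_ ->].
  apply: measurable_funS ma; first exact: lebesgueR_measurable.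
  by apply: subset_itvl; rewrite bnd_simp.
apply: (@eq_measurable_fun _ _ _ _ _ (cst u : lebesgueR R -> borel_rV R n)).
  by move=> s; rewrite inE/= in_itv/= andbT /switch_control ltNge => /negbTE ->.
exact: measurable_cst.
Qed.

Lemma trajectory_switch_before x alpha s0 u t : t <= s0 ->
  trajectory x (switch_control alpha s0 u) t = trajectory x alpha t.
Proof.
move=> ts; apply/rowP => i; rewrite !trajectoryE; congr (_ + _).
apply: eq_Rintegral => s; rewrite inE/= in_itv/= => /andP[_ st].
by rewrite /switch_control (le_trans st ts).
Qed.

Lemma trajectory_switch_after x alpha s0 u t : 0 <= s0 -> s0 <= t ->
    admissible alpha -> enorm u <= 1 ->
  trajectory x (switch_control alpha s0 u) t =
  trajectory x alpha s0 + (t - s0) *: u.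
Proof.
move=> s00 st adm u1; have adm' := switch_control_admissible s00 adm u1.
rewrite -(trajectory_switch_before x alpha u (lexx s0)).
apply/rowP => i; rewrite trajectoryE mxE trajectoryE mxE -addrA; congr (_ + _).
apply/eqP; rewrite addrC -subr_eq iint_sub//; last exact: admissible_integrable_upto.
rewrite (@eq_Rintegral _ _ _ _ _ (cst (u ord0 i))); last first.
  move=> s; rewrite inE/= in_itv/= => /andP[ss _].
  by rewrite /switch_control leNgt ss.
rewrite Rintegral_cst; last exact: lebesgueR_measurable.
rewrite -[X in fine X]/(completed_lebesgue_measure `]s0, t]).
by rewrite completed_lebesgue_measure_oc// mulrC.
Qed.

End trajectories.

(** * Comparison of costs *)

(** Clamping the argument at 0 is 1-Lipschitz and lands in the half-line, so the composition is
    continuous on the whole line, as the integral estimates ask. *)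
Lemma continuous_comp_max0 (R : realType) (f : R -> R) :
  {within `[0, +oo[, continuous f} -> continuous (fun u : R => f (Num.max 0 u)).
Proof.
move=> /subspace_continuousP cf u; apply/cvgrPdist_lt => e e0; set p := Num.max 0 u.
have Ap : `[0, +oo[%classic p by rewrite /= in_itv/= andbT le_max lexx.
have /cvgrPdist_lt/(_ _ e0) := cf _ Ap.
move=> /nbhs_ballP[d /= d0 Hd].
near=> v; apply: Hd; last by rewrite /= in_itv/= andbT le_max lexx.
have vu : `|u - v| < d by near: v; exact: cvgr_dist_lt.
rewrite /ball/=; apply: le_lt_trans vu.
have h1 : (u : R) - v <= `|(u : R) - v| := ler_norm _.
have h2 : - `|(u : R) - v| <= (u : R) - v by rewrite lerNl opprB distrC ler_norm.
rewrite /p /Num.max.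
by case: ltP => ?; case: ltP => ?; rewrite ler_norml; apply/andP; split; lra.
Unshelve. all: by end_near. Qed.

(** The endpoints come in either order here because they will be values of the distance to the
    target, which may grow or shrink in time. *)
Lemma iint_near_sym (R : realType) (f : R -> R) (s e : R) : continuous f -> 0 < e ->
  exists2 d, 0 < d & forall a b, 0 <= a -> 0 <= b ->
    `|a - s| < d -> `|b - s| < d ->
    `|iint f b - iint f a - f s * (b - a)| <= e * `|b - a|.
Proof.
move=> cf e0; have [d d0 Hd] := iint_near s cf e0.
exists d => // a b a0 b0; rewrite !ltr_norml => ad bd.
have [ab|ba] := leP a b.
  by rewrite [X in _ <= e * X]ger0_norm ?subr_ge0//; apply: Hd => //; lra.
rewrite distrC [X in _ <= e * X]distrC [X in _ <= e * X]ger0_norm ?subr_ge0 ?(ltW ba)//.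
have -> : f s * (b - a) - (iint f b - iint f a) =
  iint f a - iint f b - f s * (a - b) by ring.
by apply: Hd => //; lra.
Qed.

Lemma min_lipschitz (R : realDomainType) (c x y e : R) : `|x - y| <= e ->
  `|Num.min x c - Num.min y c| <= e.
Proof.
move=> xy; have e0 : 0 <= e := le_trans (normr_ge0 _) xy.
move: xy; rewrite !ler_norml => xy; rewrite /Num.min.
by case: ltP => ?; case: ltP => ?; lra.
Qed.

(* Subtracting [eta] from both running costs [L] and [g] turns monotonicity of
   the potential [iint L s + iint g (min (dl s) r)] into a quantitative gain. *)
Lemma cost_potential_gain (R : realType) (L g dl : R -> R) (a b eta r : R) :
  0 <= a -> a <= b -> 0 <= r -> continuous L -> continuous g ->
  (forall s, 0 <= dl s) ->
  (forall s t, 0 <= s -> s <= t -> `|dl t - dl s| <= t - s) ->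
  (forall s, a <= s <= b -> dl s <= r -> L s = g (dl s)) ->
  (forall s, a <= s <= b -> eta <= L s) ->
  eta * (b + Num.min (dl b) r - a - Num.min (dl a) r) <=
    iint L b - iint L a + iint g (Num.min (dl b) r) - iint g (Num.min (dl a) r).
Proof.
move=> a0 ab r0 cL cg dl0 dll Lg etaL; pose m s := Num.min (dl s) r.
rewrite -![Num.min (dl _) r]/(m _).
have m0 s : 0 <= m s by rewrite /m le_min dl0.
have ml s t : 0 <= s -> s <= t -> `|m t - m s| <= t - s.
  by move=> s0 st; apply: min_lipschitz; exact: dll.
suff : iint L a + iint g (m a) - eta * (a + m a) <=
       iint L b + iint g (m b) - eta * (b + m b) by lra.
apply: (@nondecreasing_of_local _
  (fun s => iint L s + iint g (m s) - eta * (s + m s)) a b ab) => s e asb e0.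
have [as_ sb] := andP asb.
have s0 : 0 <= s := le_trans a0 as_.
(* Where [dl s > r], the truncated distance is constantly [r] near [s], so only the running cost
   varies and the bound [eta <= L] suffices. *)
have [dr|dr] := leP (dl s) r; last first.
  exists (dl s - r); first by rewrite subr_gt0.
  move=> u v au vb us sv su vs; have u0 : 0 <= u := le_trans a0 au.
  have mu : m u = r.
    by rewrite /m min_r//; have := dll _ _ u0 us; rewrite ler_norml; lra.
  have mv : m v = r.
    by rewrite /m min_r//; have := dll _ _ s0 sv; rewrite ler_norml; lra.
  have : eta * (v - u) <= iint L v - iint L u.
    apply: iint_ge => //; [lra|exact: continuous_integrable_upto|].
    by move=> w uwv; apply: etaL; lra.
  have : 0 <= e * (v - u) by rewrite mulr_ge0 ?(ltW e0)//; lra.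
  by rewrite mu mv; lra.
have e20 : 0 < e / 2 by lra.
have [d1 d10 H1] := iint_near_sym s cL e20.
have [d2 d20 H2] := iint_near_sym (m s) cg e20.
exists (Num.min d1 d2); first by rewrite lt_min d10.
move=> u v au vb us sv su vs; have u0 : 0 <= u := le_trans a0 au.
have [d1' d2'] : Num.min d1 d2 <= d1 /\ Num.min d1 d2 <= d2.
  by rewrite !ge_min !lexx orbT.
have uv : u <= v := le_trans us sv.
have us1 : `|u - s| < d1 by rewrite ltr_norml; lra.
have vs1 : `|v - s| < d1 by rewrite ltr_norml; lra.
have := H1 u v u0 (le_trans u0 uv) us1 vs1.
rewrite (ger0_norm (_ : 0 <= v - u)) ?subr_ge0// ler_norml => A.
have mus : `|m u - m s| < d2.
  by rewrite distrC (le_lt_trans (ml _ _ u0 us))//; lra.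
have mvs : `|m v - m s| < d2.
  by rewrite (le_lt_trans (ml _ _ s0 sv))//; lra.
have := H2 _ _ (m0 u) (m0 v) mus mvs.
(* Here both primitives have the same slope [L s] at [s]; each contributes an error of at most
   [e / 2 * (v - u)], as [m] is 1-Lipschitz. *)
have ms : g (m s) = L s by rewrite /m min_l// Lg.
rewrite ms => /le_trans/(_ (ler_wpM2l (ltW e20) (ml _ _ u0 uv))).
rewrite ler_norml => B.
have muv := ml _ _ u0 uv; rewrite ler_norml in muv.
(* The main term is nonnegative: [m] decreases by at most [v - u], and [eta <= L s]. *)
have C : 0 <= (L s - eta) * (v - u + (m v - m u)).
  by rewrite mulr_ge0// ?subr_ge0 ?etaL//; lra.
by lra.
Qed.

(** The sum [iint L s + iint g (c - s)] has derivative [L s - g (c - s) = 0]. Only one inequality is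
    needed, so monotonicity is applied to its negative. *)
Lemma cost_of_steepest_descent (R : realType) (L g : R -> R) (a c : R) :
  0 <= a -> a <= c -> continuous L -> continuous g ->
  (forall s, a <= s <= c -> L s = g (c - s)) ->
  iint L c - iint L a <= iint g (c - a).
Proof.
move=> a0 ac cL cg Lg.
suff : - (iint L a + iint g (c - a)) <= - (iint L c + iint g (c - c)).
  by rewrite subrr (@iint_le0 _ g 0)//; lra.
apply: (@nondecreasing_of_local _
  (fun s => - (iint L s + iint g (c - s))) a c ac) => s e asc e0.
have [as_ sc] := andP asc.
have e20 : 0 < e / 2 by lra.
have [d1 d10 H1] := iint_near_sym s cL e20.
have [d2 d20 H2] := iint_near_sym (c - s) cg e20.
exists (Num.min d1 d2); first by rewrite lt_min d10.
move=> u v au vc us sv su vs; have u0 : 0 <= u := le_trans a0 au.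
have [d1' d2'] : Num.min d1 d2 <= d1 /\ Num.min d1 d2 <= d2.
  by rewrite !ge_min !lexx orbT.
have uv : u <= v := le_trans us sv.
have us1 : `|u - s| < d1 by rewrite ltr_norml; lra.
have vs1 : `|v - s| < d1 by rewrite ltr_norml; lra.
have vs2 : `|c - v - (c - s)| < d2 by rewrite ltr_norml; lra.
have us2 : `|c - u - (c - s)| < d2 by rewrite ltr_norml; lra.
have := H1 u v u0 (le_trans u0 uv) us1 vs1.
have cv0 : 0 <= c - v by rewrite subr_ge0.
have cu0 : 0 <= c - u by rewrite subr_ge0 (le_trans uv).
have := H2 (c - v) (c - u) cv0 cu0 vs2 us2.
rewrite -(Lg _ asc) (_ : c - u - (c - v) = v - u); last by ring.
rewrite (ger0_norm (_ : 0 <= v - u)) ?subr_ge0// !ler_norml.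
by lra.
Qed.

(** * Hitting times and optimality *)

Section hitting_and_cost.
Context {R : realType} {n : nat} (M : set 'rV[R]_n) (l : 'rV[R]_n -> R).
Implicit Types (x : 'rV[R]_n) (alpha : R -> 'rV[R]_n).

Lemma dist_to_trajectory_lipschitz x alpha s t :
    M !=set0 -> admissible alpha -> 0 <= s -> s <= t ->
  `|dist_to M (trajectory x alpha t) - dist_to M (trajectory x alpha s)| <= t - s.
Proof.
move=> M0 adm s0 st; have := trajectory_lipschitz x adm s0 st.
move: (trajectory x alpha t) (trajectory x alpha s) => u v uv.
have := dist_to_lipschitz u v M0; have := dist_to_lipschitz v u M0.
rewrite [enorm (v - u)]enorm_distC => vu uv'; rewrite -lerBlDl in vu.
rewrite ler_norml lerNl opprB (le_trans vu uv)/=.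
by rewrite lerBlDl (le_trans uv')// lerD2l.
Qed.

Lemma hitting_time_ge0 x alpha : (0 <= hitting_time M x alpha)%E.
Proof. by apply/ereal_infP => _ [s [s0 _] <-]; rewrite lee_fin. Qed.

Lemma hitting_time_le x alpha t : 0 <= t -> M (trajectory x alpha t) ->
  (hitting_time M x alpha <= t%:E)%E.
Proof. by move=> t0 Mt; apply: ereal_inf_lbound; exists t. Qed.

Lemma notin_before_hitting_time x alpha s : 0 <= s ->
  (s%:E < hitting_time M x alpha)%E -> ~ M (trajectory x alpha s).
Proof. by move=> s0 sT /(hitting_time_le s0); rewrite leNgt sT. Qed.

Lemma hitting_time_ge_dist x alpha : M !=set0 -> admissible alpha ->
  ((dist_to M x)%:E <= hitting_time M x alpha)%E.
Proof.
move=> M0 adm; apply/ereal_infP => _ [s [s0 Ms] <-]; rewrite lee_fin.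
have := dist_to_trajectory_lipschitz x M0 adm (lexx 0) s0.
rewrite (trajectory_le0 _ _ (lexx 0)) (dist_to_mem Ms) ler_norml.
by move: (dist_to M x) => d; lra.
Qed.

(** The trajectory is in [M] at times [s] less than [e] after the infimum [t], so by the Lipschitz
    bound the distance at [t] is at most [e]. *)
Lemma dist_to_hitting_time x alpha t : M !=set0 -> admissible alpha ->
  hitting_time M x alpha = t%:E -> dist_to M (trajectory x alpha t) = 0.
Proof.
move=> M0 adm Tt; have t0 : 0 <= t by rewrite -lee_fin -Tt hitting_time_ge0.
apply/eqP; rewrite eq_le dist_to_ge0// andbT; apply/ler_addgt0Pr => e e0.
have Tfin : hitting_time M x alpha \is a fin_num by rewrite Tt.
have [_ [s [s0 Ms] <-]] := lb_ereal_inf_adherent e0 Tfin.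
rewrite -[ereal_inf _]/(hitting_time M x alpha) Tt -EFinD lte_fin => ste.
have ts : t <= s by rewrite -lee_fin -Tt hitting_time_le.
have := dist_to_trajectory_lipschitz x M0 adm t0 ts.
rewrite (dist_to_mem Ms) ler_norml.
by move: (dist_to M _) => d; lra.
Qed.

Lemma cost_domain_measurable (T : \bar R) :
  measurable ([set s : R | 0 <= s /\ (s%:E <= T)%E] : set (lebesgueR R)).
Proof.
apply: lebesgueR_measurable; apply: is_interval_measurable.
move=> a b [a0 aT] [b0 bT] c /andP[ac cb]; split; first exact: le_trans ac.
by apply: le_trans bT; rewrite lee_fin.
Qed.

Lemma running_cost_continuous x alpha : continuous l -> admissible alpha ->
  continuous (l \o trajectory x alpha).
Proof.
move=> cl adm s; apply: continuous_comp; first exact: trajectory_continuous.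
exact: cl.
Qed.

(** Together with [cost_le], this replaces the possibly infinite horizon of the cost by real-valued
    integrals; both are monotonicity of a nonnegative integral in its domain. *)
Lemma cost_ge x alpha t : continuous l -> (forall y, 0 <= l y) ->
    admissible alpha -> (t%:E <= hitting_time M x alpha)%E ->
  ((iint (l \o trajectory x alpha) t)%:E <= cost M l x alpha)%E.
Proof.
move=> cl l0 adm tT; have cL := @running_cost_continuous x _ cl adm.
have mt : measurable (`[0, t] : set (lebesgueR R)) by exact: lebesgueR_measurable.
rewrite /iint /Rintegral fineK; last first.
  by apply: integrable_fin_num => //; exact: continuous_integrable_upto.
have mD := cost_domain_measurable (hitting_time M x alpha).
apply: (@ge0_subset_integral _ _ _ (@completed_lebesgue_measure R) _ _ mt mD
  (fun s => (l (trajectory x alpha s))%:E)).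
- apply: measurable_funTS; apply/measurable_EFinP.
  exact: continuous_lebesgueR_measurable.
- by move=> s _; rewrite lee_fin.
- move=> s /=; rewrite in_itv/= => /andP[s0 st]; split => //.
  by apply: le_trans tT; rewrite lee_fin.
Qed.

Lemma cost_le x alpha t : continuous l -> (forall y, 0 <= l y) ->
    admissible alpha -> 0 <= t -> M (trajectory x alpha t) ->
  (cost M l x alpha <= (iint (l \o trajectory x alpha) t)%:E)%E.
Proof.
move=> cl l0 adm t0 Mt; have cL := @running_cost_continuous x _ cl adm.
have mt : measurable (`[0, t] : set (lebesgueR R)) by exact: lebesgueR_measurable.
rewrite /iint /Rintegral fineK; last first.
  by apply: integrable_fin_num => //; exact: continuous_integrable_upto.
have mD := cost_domain_measurable (hitting_time M x alpha).
apply: (@ge0_subset_integral _ _ _ (@completed_lebesgue_measure R) _ _ mD mt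
  (fun s => (l (trajectory x alpha s))%:E)).
- apply: measurable_funTS; apply/measurable_EFinP.
  exact: continuous_lebesgueR_measurable.
- by move=> s _; rewrite lee_fin.
- move=> s /= [s0 sT]; rewrite in_itv/= s0 -lee_fin.
  exact: le_trans (hitting_time_le t0 Mt).
Qed.

(** The competitor follows [alpha] until [s0] and then runs straight to a nearest point of [M], at
    unit speed unless it is already there. *)
Lemma straight_competitor x alpha s0 : M !=set0 -> closed M ->
    admissible alpha -> 0 <= s0 ->
  exists beta, [/\ admissible beta,
    forall t, t <= s0 -> trajectory x beta t = trajectory x alpha t &
    M (trajectory x beta (s0 + dist_to M (trajectory x alpha s0)))].
Proof.
move=> M0 cM adm s00; set y := trajectory x alpha s0; set d := dist_to M y.
have [m Mm ym] := dist_to_attained y M0 cM.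
have d0 : 0 <= d by exact: dist_to_ge0.
(* When [d = 0] the inverse is 0 by convention, so [u] vanishes and the competitor stays put. *)
pose u := d^-1 *: (m - y).
have u1 : enorm u <= 1.
  rewrite enormZ enorm_distC ym -/d ger0_norm ?invr_ge0//.
  by have [->|dN0] := eqVneq d 0; rewrite ?mulr0// mulVf.
exists (switch_control alpha s0 u); split.
- exact: switch_control_admissible.
- by move=> t; exact: trajectory_switch_before.
rewrite trajectory_switch_after ?lerDl// (addrC s0) addrK -/y /u.
suff -> : d *: (d^-1 *: (m - y)) = m - y by rewrite addrC subrK.
have [dE|dN0] := eqVneq d 0; last by rewrite scalerA divff// scale1r.
have : enorm (y - m) = 0 by rewrite ym.
by move=> /enorm_eq0/subr0_eq ->; rewrite subrr !scaler0.
Qed.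

End hitting_and_cost.

(** The Lipschitz bound from [a] gives the lower estimate, the one back from [b] the upper
    estimate. *)
Lemma lipschitz_steepest (R : realDomainType) (f : R -> R) (a b s : R) :
    0 <= a -> (forall u v, 0 <= u -> u <= v -> `|f v - f u| <= v - u) ->
    f a = b - a -> f b = 0 -> a <= s <= b ->
  f s = b - s.
Proof.
move=> a0 lip fa fb /andP[as_ sb].
have := lip _ _ a0 as_; have := lip _ _ (le_trans a0 as_) sb.
by rewrite fa fb !ler_norml => h1 h2; apply: le_anti; lra.
Qed.

(** * Optimal controls: finite cost, approach to the target, bound on the hitting time *)

Section optimal_controls.
Context {R : realType} {n : nat} (M : set 'rV[R]_n) (l : 'rV[R]_n -> R).
Hypotheses (M0 : M !=set0) (Mclosed : closed M) (lcont : continuous l).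
Hypothesis lpos : forall x, ~ M x -> 0 < l x.
Hypothesis lzero : forall x, M x -> l x = 0.
Implicit Types (x : 'rV[R]_n) (alpha : R -> 'rV[R]_n).

Let l_ge0 x : 0 <= l x.
Proof. by have [/lzero ->//|/lpos/ltW] := pselect (M x). Qed.

Let traj_cost_continuous x alpha : admissible alpha ->
  continuous (l \o trajectory x alpha).
Proof. exact: running_cost_continuous. Qed.

(** The straight segment from [x] reaches the target in finite time, and its cost bounds the
    value. *)
Lemma optimal_cost_lty x alpha : optimal M l x alpha ->
  exists c : R, (cost M l x alpha <= c%:E)%E.
Proof.
move=> [adm ->].
have [beta [admb _ Mb]] := straight_competitor x M0 Mclosed adm (lexx 0).
eexists; apply: le_trans (cost_le lcont l_ge0 admb _ Mb).
  by apply: ereal_inf_lbound; exists beta.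
by rewrite add0r dist_to_ge0.
Qed.

(** A finite hitting time is itself such a [t]. If the target is never hit and the distance stays
    above [e], the cost grows at rate at least [gamma] forever. *)
Lemma trajectory_gets_close x alpha t0 e : admissible alpha ->
    (forall delta : R, 0 < delta -> exists2 gamma : R, 0 < gamma &
      (gamma%:E <
        ereal_inf [set (l y)%:E | y in [set y | (delta < dist_to M y)%R]])%E) ->
    (exists c : R, (cost M l x alpha <= c%:E)%E) ->
    0 <= t0 -> (t0%:E <= hitting_time M x alpha)%E -> 0 < e ->
  exists t, [/\ t0 <= t, (t%:E <= hitting_time M x alpha)%E &
    dist_to M (trajectory x alpha t) <= e].
Proof.
move=> adm linf [c costc] t00 t0T e0.
case TE : (hitting_time M x alpha) (hitting_time_ge0 M x alpha) => [T| |]//= _.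
  exists T; rewrite lexx (dist_to_hitting_time M0 adm TE) (ltW e0); split => //.
  by move: t0T; rewrite TE lee_fin.
apply: contrapT => H.
have far t : t0 <= t -> e < dist_to M (trajectory x alpha t).
  by move=> t0t; rewrite ltNge; apply/negP => d; apply: H; exists t; rewrite leey.
have [gamma gamma0 gammal] := linf _ e0.
have lg t : t0 <= t -> gamma <= l (trajectory x alpha t).
  move=> t0t; rewrite -lee_fin (le_trans (ltW gammal))//.
  by apply: ereal_inf_lbound; exists (trajectory x alpha t) => //=; exact: far.
have c0 : 0 <= c.
  rewrite -lee_fin (le_trans _ costc)//.
  by apply: integral_ge0 => s _; rewrite lee_fin.
pose L := l \o trajectory x alpha.
have cL : continuous L := @traj_cost_continuous x alpha adm.
(* At rate [gamma], this lapse of time costs [c + 1], more than the bound [c]. *)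
pose t := t0 + (c + 1) / gamma.
have t0t : t0 <= t by rewrite lerDl divr_ge0 ?addr_ge0// ltW.
have : ((iint L t)%:E <= c%:E)%E.
  by rewrite (le_trans _ costc)// cost_ge// TE leey.
rewrite lee_fin.
have : gamma * (t - t0) <= iint L t - iint L t0.
  apply: iint_ge => //; first exact: continuous_integrable_upto.
  by move=> s /andP[t0s _]; exact: lg.
have -> : gamma * (t - t0) = c + 1.
  by rewrite /t addrC addKr mulrC divfK// gt_eqF.
have : 0 <= iint L t0 by apply: Rintegral_ge0 => s _; exact: l_ge0.
by move: (iint L t) (iint L t0) => a b; lra.
Qed.

Lemma optimal_hitting_time_le (r : R) (g : R -> R) x alpha s0 :
    (forall delta : R, 0 < delta -> exists2 gamma : R, 0 < gamma &
      (gamma%:E <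
        ereal_inf [set (l y)%:E | y in [set y | (delta < dist_to M y)%R]])%E) ->
    0 < r -> continuous g -> g 0 = 0 ->
    (forall y, dist_to M y <= r -> l y = g (dist_to M y)) ->
    optimal M l x alpha -> 0 <= s0 -> (s0%:E <= hitting_time M x alpha)%E ->
    dist_to M (trajectory x alpha s0) <= r ->
  (hitting_time M x alpha <= (s0 + dist_to M (trajectory x alpha s0))%:E)%E.
Proof.
move=> linf r0 cg g0 lg opt s00 s0T; have [adm costE] := opt.
pose dl s := dist_to M (trajectory x alpha s); rewrite -/(dl s0) => dr.
have dl0 s : 0 <= dl s by exact: dist_to_ge0.
have dll s t : 0 <= s -> s <= t -> `|dl t - dl s| <= t - s.
  exact: dist_to_trajectory_lipschitz.
pose L := l \o trajectory x alpha.
have cL : continuous L := @traj_cost_continuous x alpha adm.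
rewrite leNgt; apply/negP => ltT.
(* [t0] is a time after the arrival of the straight competitor at which [alpha] has still not met
   the target. *)
have [t0 dt0 t0T] : exists2 t0, s0 + dl s0 < t0 & (t0%:E < hitting_time M x alpha)%E.
  case: (hitting_time M x alpha) ltT => [T| |]//=.
    by rewrite lte_fin => ltT; exists ((s0 + dl s0 + T) / 2); rewrite ?lte_fin; lra.
  by exists (s0 + dl s0 + 1); rewrite ?ltry//; lra.
have s0t0 : s0 <= t0 by have := dl0 s0; lra.
have t00 : 0 <= t0 := le_trans s00 s0t0.
(* [eta] is the minimum of the running cost on a compact interval that ends before the hitting time,
   hence positive. *)
have [eta eta0 etaL] : exists2 eta, 0 < eta & forall s, s0 <= s <= t0 -> eta <= L s.
  have [c cI cmin] := @EVT_min R L s0 t0 s0t0 (continuous_subspaceT cL).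
  exists (L c) => [|s sI]; last by apply: cmin; rewrite in_itv.
  move: cI; rewrite in_itv/= => /andP[s0c ct0].
  apply/lpos/(@notin_before_hitting_time _ _ M); first exact: le_trans s0c.
  by apply: le_lt_trans t0T; rewrite lee_fin.
(* [kappa] is the excess cost forced by the delay. As [g 0 = 0], the primitive of [g] is at most its
   argument near 0, so the leftover at distance [e] is at most [kappa / 2]. *)
pose kappa := eta * (t0 - s0 - dl s0).
have kappa0 : 0 < kappa by rewrite mulr_gt0//; lra.
have [d d0 Hd] := @iint_near _ g 0 1 cg ltr01.
have [e e0 [ed ek]] : exists2 e, 0 < e & e < d /\ e <= kappa / 2.
  exists (Num.min (d / 2) (kappa / 2)); first by rewrite lt_min !divr_gt0.
  rewrite gt_min ge_min lexx orbT; split => //.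
  by rewrite ltr_pdivrMr// ltr_pMr// ltr1n.
(* [t2] stands in for the hitting time, which may still be infinite at this point. *)
have [t2 [t0t2 t2T dt2]] := trajectory_gets_close adm linf
  (optimal_cost_lty opt) t00 (ltW t0T) e0.
pose m s := Num.min (dl s) r.
have m0 s : 0 <= m s by rewrite le_min dl0 (ltW r0).
have Gm : iint g (m t2) <= kappa / 2.
  have me : m t2 <= e by rewrite ge_min dt2.
  have := Hd 0 (m t2) (lexx 0) (m0 _); rewrite g0 (@iint_le0 _ g 0)//.
  have h1 : 0 - d < 0 by rewrite sub0r oppr_lt0.
  have h2 : m t2 < 0 + d by rewrite add0r (le_lt_trans me).
  move=> /(_ h1 h2); rewrite !subr0 mul0r subr0 mul1r.
  by move=> /(le_trans (ler_norm _))/le_trans; apply; exact: le_trans me ek.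
(* The strict gain is collected on [[s0, t0]]; on [[t0, t2]] plain monotonicity, with [eta = 0], is
   enough. *)
have gain1 : eta * (t0 + m t0 - s0 - m s0) <=
    iint L t0 - iint L s0 + iint g (m t0) - iint g (m s0).
  exact: (@cost_potential_gain _ L g dl s0 t0 eta r s00 s0t0 (ltW r0) cL cg
    dl0 dll (fun s _ => lg _) etaL).
have gain2 : 0 * (t2 + m t2 - t0 - m t0) <=
    iint L t2 - iint L t0 + iint g (m t2) - iint g (m t0).
  exact: (@cost_potential_gain _ L g dl t0 t2 0 r t00 t0t2 (ltW r0) cL cg
    dl0 dll (fun s _ => lg _) (fun s _ => l_ge0 _)).
have [beta [admb bE Mb]] := straight_competitor x M0 Mclosed adm s00.
rewrite -/(dl s0) in Mb.
pose T' := s0 + dl s0; pose L' := l \o trajectory x beta.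
have s0T' : s0 <= T' by rewrite lerDl.
have cL' : continuous L' := @traj_cost_continuous x beta admb.
have db s : s0 <= s <= T' -> dist_to M (trajectory x beta s) = T' - s.
  have lip u v : 0 <= u -> u <= v ->
      `|dist_to M (trajectory x beta v) - dist_to M (trajectory x beta u)| <= v - u.
    exact: dist_to_trajectory_lipschitz.
  have bs0 : dist_to M (trajectory x beta s0) = T' - s0.
    by rewrite (bE _ (lexx s0)) /T' addrC addKr.
  move=> sI.
  exact: (@lipschitz_steepest _ (fun t => dist_to M (trajectory x beta t))
    s0 T' s s00 lip bs0 (dist_to_mem Mb) sI).
have costb : iint L' T' - iint L' s0 <= iint g (dl s0).
  have -> : dl s0 = T' - s0 by rewrite /T' addrC addKr.
  apply: cost_of_steepest_descent => // s sI.
  rewrite /L'/= lg db//; case/andP: sI => s0s _.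
  by rewrite (le_trans _ dr)// lerBlDr [leLHS]addrC lerD2l.
have L's0 : iint L' s0 = iint L s0.
  apply: eq_Rintegral => s; rewrite inE/= in_itv/= => /andP[_ ss0].
  by rewrite /L' /L /= bE.
have le1 : (cost M l x alpha <= (iint L' T')%:E)%E.
  rewrite costE; apply: le_trans (cost_le lcont l_ge0 admb _ Mb).
    by apply: ereal_inf_lbound; exists beta.
  exact: le_trans s0T'.
have le2 : iint L t2 <= iint L' T'.
  by rewrite -lee_fin; exact: le_trans (cost_ge lcont l_ge0 adm t2T) le1.
have mt0 : 0 <= eta * m t0 := mulr_ge0 (ltW eta0) (m0 t0).
have ms0 : m s0 = dl s0 by rewrite /m min_l.
rewrite ms0 in gain1; rewrite mul0r in gain2; rewrite L's0 in costb.
(* The gains add up to at least [kappa], while optimality against the competitor and the small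
   leftover allow at most [kappa / 2]. Variables replace the integrals to leave pure arithmetic. *)
have arith (et t ds mt Lb L2 L0 Ls G2 G0 Gd : R) :
    et * (t + mt - s0 - ds) <= L0 - Ls + G0 - Gd -> 0 <= L2 - L0 + G2 - G0 ->
    G2 <= et * (t - s0 - ds) / 2 -> Lb - Ls <= Gd -> L2 <= Lb -> 0 <= et * mt ->
    0 < et * (t - s0 - ds) -> False.
  by clear; move=> *; lra.
exact: arith gain1 gain2 Gm costb le2 mt0 kappa0.
Qed.

End optimal_controls.

Theorem proposition3p1 (R : realType) (n : nat) (M : set 'rV[R]_n)
    (l : 'rV[R]_n -> R) (r : R) (gt : R -> R)
    (M0 : M !=set0) (Mclosed : closed M)
    (lcont : continuous l) (lbounded : bounded_fun l)
    (lpos : forall x, ~ M x -> 0 < l x)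
    (lzero : forall x, M x -> l x = 0)
    (linf : forall delta : R, 0 < delta -> exists2 gamma : R, 0 < gamma &
      (gamma%:E <
        ereal_inf [set (l x)%:E | x in [set x | (delta < dist_to M x)%R]])%E)
    (rpos : 0 < r)
    (gtcont : {within `[0, +oo[, continuous gt})
    (gtge0 : forall s, 0 <= s -> 0 <= gt s)
    (gt0 : gt 0 = 0)
    (gtpos : forall s, 0 < s -> 0 < gt s)
    (lgt : forall x, dist_to M x <= r -> l x = gt (dist_to M x)) :
  forall (x : 'rV[R]_n) (alpha : R -> 'rV[R]_n), optimal M l x alpha ->
    (dist_to M x <= r -> hitting_time M x alpha = (dist_to M x)%:E) /\
    (hitting_time M x alpha < +oo)%E.
Proof.
move=> x alpha opt; have [adm _] := opt.
pose g u := gt (Num.max 0 u).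
have cg : continuous g := continuous_comp_max0 gtcont.
have g0 : g 0 = 0 by rewrite /g maxxx.
have lg y : dist_to M y <= r -> l y = g (dist_to M y).
  by move=> /lgt ->; rewrite /g max_r// dist_to_ge0.
have hit := optimal_hitting_time_le M0 Mclosed lcont lpos lzero linf rpos cg g0 lg opt.
(* The first claim takes [s0 = 0], with the reverse inequality due to unit speed. The second starts
   from a time at which the distance is at most [r]. *)
split => [dxr|].
  have := hit 0 (lexx 0) (hitting_time_ge0 M x alpha).
  rewrite (trajectory_le0 _ _ (lexx 0)) add0r => /(_ dxr) T_le.
  by apply: le_anti; rewrite T_le hitting_time_ge_dist.
have [s [s0 sT ds]] := trajectory_gets_close M0 lcont lpos lzero adm linf
  (optimal_cost_lty M0 Mclosed lcont lpos lzero opt) (lexx 0)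
  (hitting_time_ge0 M x alpha) rpos.
exact: le_lt_trans (hit s s0 sT ds) (ltry _).
Qed.
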